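(* Let the communication graph on $\Omega=\{1,\dots,n\}$, with Laplacian $L$, be well connected, meaning that it is connected and that the second largest eigenvalue $1-\rho$ of the matrix $I-\beta\Lambda^{-1}L$, where $\Lambda=\mathrm{diag}\{(2a_1)^{-1},\dots,(2a_n)^{-1}\}$, satisfies $$(1-\rho)\,\max_{i\in\Omega}a_i^{1/2}\,\max_{i\in\Omega}a_i^{-1/2}<1 .$$ Suppose that $|\Delta P_L(t+1)-\Delta P_L(t)|<\epsilon$ for all $t\in\mathcal{T}=\{1,\dots,T\}$, and that the zero-time-constant assumption holds, so that $\Delta P_m^i(t)=u_i(t)$ for all $i\in\Omega$, $t\in\mathcal{T}$. Then there exists a constant $c>0$, depending only on the cost parameters and the communication topology, such that the control signals $u_i$ produced by the distributed control scheme described in the context are $c\epsilon$-close to their optimal values. More precisely, $$|\lambda_i^t-\lambda^t|\le c\,\epsilon\qquad\text{for all } t\in\mathcal{T},\ i\in\Omega,$$ $$|u_i(t)-u_i^*(t)|\le c\,\epsilon\qquad\text{for all } t\in\mathcal{T},\ i\in\Omega,$$ where $(u_1^*(t),\dots,u_n^*(t))$ is the optimal dispatch and $\lambda^t$ the optimal multiplier at time $t$, defined in the context.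
   Context: There are $n$ frequency regulation resources, indexed by $\Omega=\{1,\dots,n\}$. Time is divided into slots $\mathcal{T}=\{1,\dots,T\}$. At time slot $t$, $\Delta P_L(t)\in\mathbb{R}$ is the deviation of the load from its predicted value (it changes only at the beginning of a slot and is constant during the slot), $\Delta P_m^i(t)\in\mathbb{R}$ is the regulation contribution of resource $i$, and $u_i(t)\in\mathbb{R}$ is its secondary frequency control signal. Resource $i$ has a quadratic dispatch cost with quadratic coefficient $a_i>0$; the linear cost coefficients of all resources are assumed identical, so that only the terms $a_iu_i^2$ matter in the optimal dispatch. The resources communicate over an undirected graph; $\Omega_i$ is the set of neighbors of $i$, and $L=D_G-A_G$ is the graph Laplacian (degree matrix minus adjacency matrix). The number $\beta>0$ is a tuning parameter of the scheme. The matrix $I-\beta\Lambda^{-1}L$ is similar to the symmetric matrix $I-\beta\Lambda^{-1/2}L\Lambda^{-1/2}$, so its eigenvalues are real; its largest eigenvalue is $1$. Distributed control scheme (consensus-plus-global-innovation): each resource $i$ keeps a local marginal-cost variable $\lambda_i^t=2a_i\,\Delta P_m^i(t)$ and in the step from $t$ to $t+1$ performs $$\tilde\lambda_i^{t+1}=\lambda_i^t-2a_i\beta\sum_{l\in\Omega_i}(\lambda_i^t-\lambda_l^t)+\frac{2a_i}{n}\Bigl(\Delta P_L(t+1)-\sum_{j\in\Omega}\Delta P_m^j(t)\Bigr),$$ $$u_i(t+1)=\frac{1}{2a_i}\tilde\lambda_i^{t+1},\qquad \lambda_i^{t+1}=2a_i\,\Delta P_m^i(t+1).$$ Zero-time-constant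 assumption: the governor and turbine time constants of all resources are zero, so that $\Delta P_m^i(t)=u_i(t)$ for all $i\in\Omega$ and $t\in\mathcal{T}$. Optimal dispatch: at each time $t$, $(u_1^*(t),\dots,u_n^*(t))$ is the minimizer of $\sum_{i\in\Omega}a_iu_i^2$ subject to $\sum_{i\in\Omega}u_i=\Delta P_L(t)$, and $\lambda^t$ is the associated Lagrange multiplier; equivalently, they solve the first order optimality conditions $$2a_iu_i^*(t)-\lambda^t=0\ \ (i\in\Omega),\qquad \sum_{i\in\Omega}u_i^*(t)-\Delta P_L(t)=0.$$
   Formalization: Adds an initial condition |λ_i^1−λ^1| ≤ Kε, with c allowed to depend on K (the claim at t=1 is false for arbitrary initial states); ''second largest eigenvalue'' is taken in modulus with |1−ρ| in the condition, since with the signed order the iteration can diverge. *)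

(* Defs.v *)
From mathcomp Require Import all_boot all_order all_algebra.
From mathcomp Require Import reals.

Set Implicit Arguments.
Unset Strict Implicit.
Unset Printing Implicit Defensive.

Import Order.TTheory GRing.Theory Num.Theory.
Local Open Scope ring_scope.

(* An undirected graph on the resources is a symmetric irreflexive relation
   [e : rel 'I_n]; the neighbours of [i] are the [l] such that [e i l]. *)

Definition adjacency_mx (R : realType) (n : nat) (e : rel 'I_n) : 'M[R]_n :=
  \matrix_(i, j) (e i j)%:R.

Definition degree_mx (R : realType) (n : nat) (e : rel 'I_n) : 'M[R]_n :=
  diag_mx (\row_i #|[set l | e i l]|%:R).

Definition laplacian (R : realType) (n : nat) (e : rel 'I_n) : 'M[R]_n :=
  degree_mx R e - adjacency_mx R e.

Definition Lambda (R : realType) (n : nat) (a : 'I_n -> R) : 'M[R]_n :=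
  diag_mx (\row_i (2 * a i)^-1).

Definition consensus_mx (R : realType) (n : nat) (a : 'I_n -> R)
    (e : rel 'I_n) (beta : R) : 'M[R]_n :=
  1%:M - beta *: (invmx (Lambda a) *m laplacian R e).

(* [s] lists the eigenvalues of [A] with multiplicity (all of them real), by
   decreasing modulus. The order cannot be the signed one: on a connected
   graph a large [beta] makes every eigenvalue of [consensus_mx] but one smaller
   than -1, and the iteration then diverges. No second eigenvalue exists when [n <= 1]. *)
Definition second_largest_eigenvalue (R : realType) (n : nat) (A : 'M[R]_n)
    (mu : R) : Prop :=
  exists s : seq R,
    [/\ char_poly A = \prod_(x <- s) ('X - x%:P),
        sorted (fun x y : R => `|y| <= `|x|) s,
        (1 < size s)%N
      & mu = s`_1].

(* The default value 0 of the maxima is harmless: all the terms are positive. *)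
Definition well_connected (R : realType) (n : nat) (a : 'I_n -> R)
    (e : rel 'I_n) (beta : R) : Prop :=
  (forall i j, connect e i j) /\
  exists rho : R,
    second_largest_eigenvalue (consensus_mx a e beta) (1 - rho) /\
    `|1 - rho| * (\big[Num.max/0]_(i < n) Num.sqrt (a i))
               * (\big[Num.max/0]_(i < n) (Num.sqrt (a i))^-1) < 1.

Definition in_horizon (T t : nat) : bool := (1 <= t <= T)%N.

(* The steps are those from [t] to [t + 1] with both slots in {1, ..., T};
   [lamt] is the tentative marginal cost (lambda tilde). *)
Record distributed_scheme (R : realType) (n : nat) (a : 'I_n -> R)
    (e : rel 'I_n) (beta : R) (T : nat) (PL : nat -> R)
    (Pm u lam lamt : 'I_n -> nat -> R) : Prop := DistributedScheme {
  scheme_marginal_cost : forall t i, in_horizon T t ->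
    lam i t = 2 * a i * Pm i t;
  scheme_innovation : forall t i, in_horizon T t -> in_horizon T t.+1 ->
    lamt i t.+1 = lam i t
      - 2 * a i * beta * (\sum_(l | e i l) (lam i t - lam l t))
      + 2 * a i / n%:R * (PL t.+1 - \sum_j Pm j t);
  scheme_control : forall t i, in_horizon T t -> in_horizon T t.+1 ->
    u i t.+1 = (2 * a i)^-1 * lamt i t.+1
}.

Definition zero_time_constant (R : realType) (n T : nat)
    (Pm u : 'I_n -> nat -> R) : Prop :=
  forall t i, in_horizon T t -> Pm i t = u i t.

Definition dispatch_cost (R : realType) (n : nat) (a v : 'I_n -> R) : R :=
  \sum_i a i * v i ^+ 2.

Definition optimal_dispatch (R : realType) (n : nat) (a : 'I_n -> R) (P : R)
    (v : 'I_n -> R) : Prop :=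
  \sum_i v i = P /\
  forall w : 'I_n -> R, \sum_i w i = P ->
    dispatch_cost a v <= dispatch_cost a w.

(* Stationarity in [v] of the Lagrangian
   [dispatch_cost a v - mu * (\sum_i v i - P)]. *)
Definition lagrange_multiplier (R : realType) (n : nat) (a v : 'I_n -> R)
    (mu : R) : Prop :=
  forall i, 2 * a i * v i - mu = 0.

(* Main.v *)
Require Import Defs.
From mathcomp Require Import all_boot all_order all_algebra.
From mathcomp Require Import reals complex ring lra.

Set Implicit Arguments.
Unset Strict Implicit.
Unset Printing Implicit Defensive.

Import Order.TTheory GRing.Theory Num.Theory.
Local Open Scope ring_scope.

(** Let [mu t i = lam i t - lamstar t] be the error on the marginal costs, and
    give resource [i] the weight [(2 * a i)^-1]. Under the scheme the error
    obeys
      [mu (t + 1) = M (mu t) + delta * g - m * h],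
    where [M] is the consensus matrix, [delta] is the load change, [m] is the
    weighted sum of [mu t], [h i = 2 * a i / n] and [g] is [h] minus the
    inverse of the total weight. Since [M] preserves weighted sums, [g] has
    weighted sum 0 and [h] has weighted sum 1, the error has weighted sum 0
    from the second slot on, and only [delta * g] still drives it.

    [M] is conjugate by the diagonal matrix of the [Num.sqrt (2 * a i)] to a
    symmetric matrix, for which the weighted norm becomes the Euclidean one
    ([scaled_consensus_mx]). By the spectral theorem [M] is therefore
    nonexpansive, and on vectors of weighted sum 0, which are orthogonal to the
    eigenvector of the simple eigenvalue 1, it contracts by the factor
    [`|1 - rho|] ([sym_contraction_orth]).

    The constant must not depend on [beta], although [`|1 - rho|] does. Let
    [k = cost_ratio a >= 1]; a well connected graph has [`|1 - rho| < k^-1].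
    If [k > 1], the contraction factor is bounded away from 1 by [k] alone, and
    a ball whose squared radius is a multiple of [eps ^+ 2] is invariant
    ([perturbed_step_bound]). If [k = 1], the factor may be arbitrarily close
    to 1, but then all the [a i] are equal, so [g = 0] and the error does not
    grow any more ([share_gap_eq0]). The first step, where [m] need not vanish,
    is bounded directly ([second_step_bound]). *)

(** * Symmetric matrices contract the orthogonal complement of an eigenvector *)

Section Spectral.
Local Open Scope sesquilinear_scope.

Lemma sum_sqr_norm (C : numClosedFieldType) (n : nat) (v : 'rV[C]_n) :
  \sum_i `|v 0 i| ^+ 2 = (v *m v^t*) 0 0.
Proof. by rewrite mxE; apply: eq_bigr => i _; rewrite !mxE normCK. Qed.

Lemma sum_sqr_norm_unitary (C : numClosedFieldType) (n : nat)
    (v : 'rV[C]_n) (U : 'M[C]_n) :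
  U \is unitarymx -> \sum_i `|(v *m U) 0 i| ^+ 2 = \sum_i `|v 0 i| ^+ 2.
Proof.
move=> /unitarymxP UU; rewrite !sum_sqr_norm trmx_mul map_mxM.
by rewrite mulmxA -[v *m U *m _]mulmxA UU mulmx1.
Qed.

(** Coordinates of row vectors in the orthonormal eigenbasis of [A] are obtained
    by multiplying with the adjoint of [spectralmx A]; there [A] is diagonal. *)
Lemma normal_mul_spectral (C : numClosedFieldType) (n : nat) (A : 'M[C]_n)
    (v : 'rV[C]_n) (i : 'I_n) : A \is normalmx ->
  (v *m A *m (spectralmx A)^t*) 0 i
    = (v *m (spectralmx A)^t*) 0 i * spectral_diag A 0 i.
Proof.
move=> /orthomx_spectralP eqA.
rewrite -(invmx_unitary (spectral_unitarymx A)) {1}eqA -!mulmxA.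
by rewrite mulmxV ?spectral_unit// mulmx1 mulmxA mul_mx_diag mxE.
Qed.

Lemma normal_contraction (C : numClosedFieldType) (n : nat) (A : 'M[C]_n)
    (q : C) (v : 'rV[C]_n) : A \is normalmx ->
  (forall i, (v *m (spectralmx A)^t*) 0 i = 0 \/ `|spectral_diag A 0 i| <= q) ->
  \sum_i `|(v *m A) 0 i| ^+ 2 <= q ^+ 2 * \sum_i `|v 0 i| ^+ 2.
Proof.
move=> Anormal bound.
have PU : (spectralmx A)^t* \is unitarymx.
  by rewrite trmxC_unitary spectral_unitarymx.
rewrite -(sum_sqr_norm_unitary (v *m A) PU) -(sum_sqr_norm_unitary v PU).
rewrite mulr_sumr; apply: ler_sum => i _.
rewrite normal_mul_spectral// normrM exprMn.
case: (bound i) => [->|le_q]; first by rewrite normr0 expr0n mul0r mulr0.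
rewrite mulrC ler_wpM2r ?exprn_ge0// lerXn2r// nnegrE//.
exact: le_trans (normr_ge0 _) le_q.
Qed.

Lemma char_poly_conj (F : fieldType) (n : nat) (P A : 'M[F]_n) :
  P \in unitmx -> char_poly (P *m A *m invmx P) = char_poly A.
Proof.
move=> Pu; pose f (M : 'M[F]_n) : 'M[{poly F}]_n := map_mx (@polyC F) M.
have eqM : char_poly_mx (P *m A *m invmx P)
    = f P *m char_poly_mx A *m f (invmx P).
  rewrite /f /char_poly_mx mulmxBr mulmxBl !map_mxM; congr (_ - _).
  by rewrite scalar_mxC -mulmxA -map_mxM mulmxV// map_mx1 mulmx1.
rewrite /char_poly eqM !det_mulmx mulrC mulrA -det_mulmx /f -map_mxM.
by rewrite mulVmx// map_mx1 det1 mul1r.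
Qed.

Lemma normal_char_poly (C : numClosedFieldType) (n : nat) (A : 'M[C]_n) :
  A \is normalmx ->
  char_poly A = \prod_(x <- [seq spectral_diag A 0 i | i : 'I_n]) ('X - x%:P).
Proof.
move=> /orthomx_spectralP eqA.
have -> : char_poly A = char_poly (diag_mx (spectral_diag A)).
  rewrite [in LHS]eqA -[X in _ *m X](invmxK (spectralmx A)).
  by rewrite char_poly_conj ?unitmx_inv ?spectral_unit.
rewrite char_poly_trig ?diag_mx_is_trig//.
by rewrite big_map big_enum; apply: eq_bigr => i _; rewrite !mxE eqxx.
Qed.

Section RealSymmetric.
Local Open Scope complex_scope.
Variables (R : rcfType) (n : nat).
Implicit Types (B : 'M[R]_n) (v w : 'rV[R]_n).

Local Notation cplx := (map_mx (real_complex R)).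

Lemma sym_complex_normal B : B^T = B -> (cplx B) \is normalmx.
Proof.
move=> Bsym; apply: symmetric_normalmx.
  by apply/is_hermitianmxP; rewrite expr0 scale1r map_mx_id// map_trmx Bsym.
by apply/mxOverP => i j; rewrite mxE; apply/complex_realP; exists (B i j).
Qed.

Lemma sum_sqr_complex v : \sum_i `|(cplx v) 0 i| ^+ 2 = (\sum_i v 0 i ^+ 2)%:C.
Proof.
rewrite raddf_sum; apply: eq_bigr => i _.
by rewrite mxE normc_def /= expr0n addr0 -rmorphXn/= sqr_sqrtr ?sqr_ge0.
Qed.

Lemma sym_spectrum B (s : seq R) : B^T = B ->
  char_poly B = \prod_(x <- s) ('X - x%:P) ->
  perm_eq [seq spectral_diag (cplx B) 0 i | i : 'I_n] [seq x%:C | x <- s].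
Proof.
move=> Bsym chB; apply: prod_XsubC_eq.
rewrite -normal_char_poly ?sym_complex_normal// -map_char_poly chB.
rewrite rmorph_prod big_map; apply: eq_bigr => x _.
by rewrite rmorphB /= map_polyX map_polyC.
Qed.

Lemma norm_real_complex (x : R) : `|x%:C| = `|x|%:C.
Proof. by rewrite normc_def /= expr0n addr0 sqrtr_sqr. Qed.

(** The real sums of squares are compared in [R[i]], where the eigenbasis
    lives. *)
Lemma sym_contraction_of_spectral B (q : R) v : B^T = B ->
  (forall i, ((cplx v) *m (spectralmx (cplx B))^t*) 0 i = 0
          \/ `|spectral_diag (cplx B) 0 i| <= q%:C) ->
  \sum_i (v *m B) 0 i ^+ 2 <= q ^+ 2 * \sum_i v 0 i ^+ 2.
Proof.
move=> Bsym bound.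
have := normal_contraction (sym_complex_normal Bsym) bound.
by rewrite -map_mxM !sum_sqr_complex -rmorphXn -rmorphM lecR.
Qed.

Lemma sym_contraction B (s : seq R) (q : R) v : B^T = B ->
  char_poly B = \prod_(x <- s) ('X - x%:P) ->
  (forall x, x \in s -> `|x| <= q) ->
  \sum_i (v *m B) 0 i ^+ 2 <= q ^+ 2 * \sum_i v 0 i ^+ 2.
Proof.
move=> Bsym chB le_q; apply: sym_contraction_of_spectral => // i; right.
have : spectral_diag (cplx B) 0 i \in [seq x%:C | x <- s].
  by rewrite -(perm_mem (sym_spectrum Bsym chB)) map_f ?mem_enum.
by case/mapP => x xs ->; rewrite norm_real_complex lecR le_q.
Qed.

(** A vector orthogonal to an eigenvector of the simple eigenvalue [l] has no
    component on [l], so only the other eigenvalues act on it. *)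
Lemma sym_contraction_orth B (l : R) (s : seq R) (q : R) v w : B^T = B ->
  char_poly B = \prod_(x <- l :: s) ('X - x%:P) ->
  l \notin s -> (forall x, x \in s -> `|x| <= q) ->
  w != 0 -> w *m B = l *: w -> \sum_i v 0 i * w 0 i = 0 ->
  \sum_i (v *m B) 0 i ^+ 2 <= q ^+ 2 * \sum_i v 0 i ^+ 2.
Proof.
move=> Bsym chB lNs le_q w_neq0 wB vw.
apply: sym_contraction_of_spectral => // i.
have eqs := sym_spectrum Bsym chB.
have : spectral_diag (cplx B) 0 i \in [seq x%:C | x <- l :: s].
  by rewrite -(perm_mem eqs) map_f ?mem_enum.
case/mapP => x; rewrite in_cons; case/predU1P => [->|xs] spi; last first.
  by right; rewrite spi norm_real_complex lecR le_q.
left; set P := (spectralmx (cplx B))^t*.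
have Pu : P \is unitarymx by rewrite trmxC_unitary spectral_unitarymx.
(* [l] is a simple eigenvalue, so [i] is the only coordinate carrying it *)
have uniq_i j : j != i -> spectral_diag (cplx B) 0 j != l%:C.
  move=> ji; apply/eqP => spj.
  have : (#|[pred k : 'I_n | (spectral_diag (cplx B) 0 k == l%:C)%R]| <= 1)%N.
    rewrite cardE -sum1_size big_filter sum1_count.
    have /seq.permP/(_ (pred1 l%:C)) := eqs; rewrite !count_map /= eqxx.
    rewrite (eq_count (a2 := pred1 l)) => [|y]; last first.
      by rewrite /= (inj_eq (@complexI R)).
    rewrite (count_memPn lNs) addn0. move=> c1.
    apply: (@leq_trans (true : nat)) => //; rewrite -c1.
    by apply: eq_leq; apply: eq_count => k; rewrite !inE.
  move/card_le1_eqP => /(_ i j); rewrite !inE spi spj eqxx => /(_ isT isT) ij.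
  by rewrite ij eqxx in ji.
pose x0 := (cplx w) *m P.
have x0j j : j != i -> x0 0 j = 0.
  move=> ji; have := normal_mul_spectral (cplx w) j (sym_complex_normal Bsym).
  rewrite -map_mxM wB map_mxZ -scalemxAl -/P -/x0 mxE mulrC.
  move/eqP; rewrite -subr_eq0 -mulrBr mulf_eq0 subr_eq0 => /orP[/eqP->//|].
  by rewrite eq_sym (negbTE (uniq_i _ ji)).
have x0i : x0 0 i != 0.
  apply: contra w_neq0 => /eqP x0i; have x00 : x0 = 0.
    by apply/rowP => j; rewrite [RHS]mxE; have [->|/x0j] := eqVneq j i.
  have : (cplx w) = 0 by rewrite -[(cplx w)](mulmxtVK _ Pu) -/x0 x00 mul0mx.
  by move/eqP; rewrite map_mx_eq0.
have : ((cplx v) *m P *m x0^t*) 0 0 = 0.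
  rewrite trmx_mul map_mxM mulmxA mulmxtVK// mxE.
  transitivity ((\sum_i v 0 i * w 0 i)%:C); last by rewrite vw.
  rewrite raddf_sum; apply: eq_bigr => j _.
  rewrite !mxE [RHS](rmorphM (real_complex R)).
  by congr (_ * _); exact: conjc_real.
rewrite mxE (bigD1 i)//= big1 ?addr0 => [|j ji]; last first.
  by rewrite [x0^t* _ _]mxE [x0^T _ _]mxE x0j// conjC0 mulr0.
rewrite [x0^t* _ _]mxE [x0^T _ _]mxE => /eqP.
by rewrite mulf_eq0 conjC_eq0 (negbTE x0i) orbF => /eqP.
Qed.
End RealSymmetric.

End Spectral.

(** * The consensus matrix in weighted coordinates *)

(** The matrix [Lambda^(-1/2)]. *)
Definition scale_mx (R : realType) (n : nat) (a : 'I_n -> R) : 'M[R]_n :=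
  diag_mx (\row_i Num.sqrt (2 * a i)).

(** The symmetric matrix [I - beta * Lambda^(-1/2) * L * Lambda^(-1/2)], similar
    to the consensus matrix. *)
Definition scaled_consensus_mx (R : realType) (n : nat) (a : 'I_n -> R)
    (e : rel 'I_n) (beta : R) : 'M[R]_n :=
  1%:M - beta *: (scale_mx a *m laplacian R e *m scale_mx a).

(** The consensus matrix acting on marginal costs: one step of the scheme
    without its innovation term. *)
Definition consensus_step (R : realType) (n : nat) (a : 'I_n -> R)
    (e : rel 'I_n) (beta : R) (mu : 'I_n -> R) (i : 'I_n) : R :=
  mu i - 2 * a i * beta * \sum_(l | e i l) (mu i - mu l).

(** Sum of [mu] with weights [(2 * a i)^-1]: the power corresponding to the
    marginal costs [mu]. *)
Definition wsum (R : realType) (n : nat) (a mu : 'I_n -> R) : R :=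
  \sum_i (2 * a i)^-1 * mu i.

(** Squared norm of [mu] for the weights [(2 * a i)^-1]. *)
Definition wnorm (R : realType) (n : nat) (a mu : 'I_n -> R) : R :=
  \sum_i (2 * a i)^-1 * mu i ^+ 2.

(** The square root of [max a / min a], in the form in which it enters
    [well_connected]. *)
Definition cost_ratio (R : realType) (n : nat) (a : 'I_n -> R) : R :=
  (\big[Num.max/0]_(i < n) Num.sqrt (a i))
  * (\big[Num.max/0]_(i < n) (Num.sqrt (a i))^-1).

Lemma laplacian_sym (R : realType) (n : nat) (e : rel 'I_n) :
  symmetric e -> (laplacian R e)^T = laplacian R e.
Proof.
move=> e_sym; rewrite /laplacian raddfB /= tr_diag_mx; congr (_ - _).
by apply/matrixP => i j; rewrite !mxE e_sym.
Qed.

Lemma mul_laplacian (R : realType) (n : nat) (e : rel 'I_n) (x : 'rV[R]_n)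
    (j : 'I_n) : symmetric e ->
  (x *m laplacian R e) 0 j = \sum_(l | e j l) (x 0 j - x 0 l).
Proof.
move=> e_sym; rewrite /laplacian mulmxBr mul_mx_diag !mxE sumrB.
congr (_ - _).
  rewrite sumr_const mulr_natr; congr (_ *+ _).
  by apply: eq_card => l; rewrite !inE.
rewrite [RHS]big_mkcond; apply: eq_bigr => l _; rewrite mxE e_sym.
by case: (e j l); rewrite ?mulr1 ?mulr0.
Qed.

Lemma scaled_consensus_sym (R : realType) (n : nat) (a : 'I_n -> R)
    (e : rel 'I_n) (beta : R) : symmetric e ->
  (scaled_consensus_mx a e beta)^T = scaled_consensus_mx a e beta.
Proof.
move=> e_sym; rewrite /scaled_consensus_mx raddfB /= linearZ /= trmx1.
by rewrite !trmx_mul laplacian_sym// tr_diag_mx mulmxA.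
Qed.

Lemma scaled_consensus_char_poly (R : realType) (n : nat) (a : 'I_n -> R)
    (e : rel 'I_n) (beta : R) : (forall i, 0 < a i) ->
  char_poly (scaled_consensus_mx a e beta) = char_poly (consensus_mx a e beta).
Proof.
move=> a_gt0; have a2_gt0 i : 0 < 2 * a i by rewrite mulr_gt0.
have Du : scale_mx a \in unitmx.
  rewrite unitmxE det_diag unitfE; apply/prodf_neq0 => i _.
  by rewrite mxE sqrtr_eq0 -ltNge.
have DD : scale_mx a *m scale_mx a = invmx (Lambda a).
  have LDD : Lambda a *m (scale_mx a *m scale_mx a) = 1%:M.
    rewrite !mulmx_diag; apply/matrixP => i j; rewrite !mxE.
    have [_|//] := eqVneq i j.
    by rewrite -expr2 sqr_sqrtr ?ltW// mulVf ?gt_eqF.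
  have [Lu _] := mulmx1_unit LDD.
  by rewrite -[LHS](mulKmx Lu) LDD mulmx1.
rewrite -(char_poly_conj _ Du); congr char_poly.
rewrite /scaled_consensus_mx /consensus_mx mulmxBr mulmxBl mulmx1 mulmxV//.
by rewrite -scalemxAr -scalemxAl !mulmxA mulmxK// DD.
Qed.

(** The change of variables [mu i / Num.sqrt (2 * a i)] turns a consensus step
    into the product with the scaled matrix. *)
Lemma mul_scaled_consensus (R : realType) (n : nat) (a : 'I_n -> R)
    (e : rel 'I_n) (beta : R) (mu : 'I_n -> R) :
  (forall i, 0 < a i) -> symmetric e ->
  (\row_i (mu i / Num.sqrt (2 * a i))) *m scaled_consensus_mx a e beta
    = \row_i (consensus_step a e beta mu i / Num.sqrt (2 * a i)).
Proof.
move=> a_gt0 e_sym; have a2_gt0 i : 0 < 2 * a i by rewrite mulr_gt0.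
have r_neq0 i : Num.sqrt (2 * a i) != 0 by rewrite sqrtr_eq0 -ltNge.
apply/rowP => j; rewrite /scaled_consensus_mx mulmxBr mulmx1 -scalemxAr !mulmxA.
have -> : (\row_i (mu i / Num.sqrt (2 * a i))) *m scale_mx a = \row_i mu i.
  by apply/rowP => i; rewrite mul_mx_diag !mxE mulfVK.
have mul_scale (x : 'rV_n) : (x *m scale_mx a) 0 j = x 0 j * Num.sqrt (2 * a j).
  by rewrite mul_mx_diag !mxE.
rewrite [in LHS]mxE [X in _ + X]mxE [X in - X]mxE mul_scale mul_laplacian//.
rewrite !mxE /consensus_step; under eq_bigr do rewrite !mxE.
set X := \sum_(l | _) _.
rewrite -{3}(sqr_sqrtr (ltW (a2_gt0 j))); have := r_neq0 j.
move: (Num.sqrt _) => r r0; field.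
exact: r0.
Qed.

Lemma consensus_step_const (R : realType) (n : nat) (a : 'I_n -> R)
    (e : rel 'I_n) (beta c : R) (i : 'I_n) :
  consensus_step a e beta (fun=> c) i = c.
Proof. by rewrite /consensus_step big1 ?mulr0 ?subr0// => l _; rewrite subrr. Qed.

Lemma wnormE (R : realType) (n : nat) (a mu : 'I_n -> R) :
  (forall i, 0 < a i) ->
  wnorm a mu = \sum_i (\row_k (mu k / Num.sqrt (2 * a k))) 0 i ^+ 2.
Proof.
move=> a_gt0; apply: eq_bigr => i _.
by rewrite mxE expr_div_n sqr_sqrtr ?mulr_ge0 ?ltW// mulrC.
Qed.

Lemma cost_ratio_ge (R : realType) (n : nat) (a : 'I_n -> R) (i j : 'I_n) :
  Num.sqrt (a i) / Num.sqrt (a j) <= cost_ratio a.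
Proof.
apply: ler_pM; rewrite ?invr_ge0 ?sqrtr_ge0//.
  exact: (le_bigmax _ (fun i => Num.sqrt (a i))).
exact: (le_bigmax _ (fun i => (Num.sqrt (a i))^-1)).
Qed.

Lemma cost_ratio_ge1 (R : realType) (n : nat) (a : 'I_n -> R) (i : 'I_n) :
  0 < a i -> 1 <= cost_ratio a.
Proof.
move=> ai; apply: le_trans (cost_ratio_ge a i i).
by rewrite divff ?lexx// sqrtr_eq0 -ltNge.
Qed.

Lemma cost_ratio_eq1 (R : realType) (n : nat) (a : 'I_n -> R) (i j : 'I_n) :
  (forall i, 0 < a i) -> cost_ratio a = 1 -> a i = a j.
Proof.
move=> a_gt0 k1; apply/eqP; rewrite eq_le.
suff le_a k l : a k <= a l by rewrite !le_a.
have := cost_ratio_ge a k l.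
by rewrite k1 ler_pdivrMr ?sqrtr_gt0 ?a_gt0// mul1r ler_sqrt ?(ltW (a_gt0 l)).
Qed.

(** The second eigenvalue in modulus is smaller than 1, and 1 is an eigenvalue
    because constant vectors are fixed; hence 1 comes first and is simple. *)
Lemma well_connected_spectrum (R : realType) (n : nat) (a : 'I_n -> R)
    (e : rel 'I_n) (beta : R) (i0 : 'I_n) :
  (forall i, 0 < a i) -> symmetric e -> well_connected a e beta ->
  exists (q : R) (s : seq R),
    [/\ char_poly (scaled_consensus_mx a e beta)
          = \prod_(x <- 1 :: s) ('X - x%:P),
        1 \notin s, forall x, x \in s -> `|x| <= q
      & 0 <= q /\ q * cost_ratio a < 1].
Proof.
move=> a_gt0 e_sym [_ [rho [[s [chM sorted_s size_s rho_s]] lt1]]].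
have k_ge1 := cost_ratio_ge1 (a_gt0 i0).
have qk : `|1 - rho| * cost_ratio a < 1 by rewrite mulrA.
have q_lt1 : `|1 - rho| < 1.
  by apply: le_lt_trans qk; rewrite ler_peMr.
have root1 : 1 \in s.
  rewrite -root_prod_XsubC -chM -(scaled_consensus_char_poly _ _ a_gt0).
  rewrite -eigenvalue_root_char; apply/eigenvalueP.
  exists (\row_i ((fun=> 1) i / Num.sqrt (2 * a i))).
    rewrite (mul_scaled_consensus _ _ a_gt0 e_sym) scale1r.
    by apply/rowP => j; rewrite !mxE consensus_step_const.
  apply/eqP => /rowP/(_ i0); rewrite !mxE mul1r => /eqP.
  by rewrite invr_eq0 sqrtr_eq0 leNgt mulr_gt0.
rewrite (scaled_consensus_char_poly _ _ a_gt0) chM.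
case: s sorted_s size_s rho_s root1 chM => [|x0 [|x1 s]]//=.
move=> sorted_s _ rho_x1 root1 chM.
have le_q x : x \in x1 :: s -> `|x| <= `|1 - rho|.
  rewrite rho_x1; move: sorted_s => /andP[_ path_s]; rewrite in_cons.
  case/predU1P => [->//|xs].
  have tr : transitive (fun x y : R => `|y| <= `|x|).
    by move=> y z t yz ty; exact: le_trans ty yz.
  by move: path_s; rewrite (path_sortedE tr) => /andP[/allP/(_ _ xs)].
have Nroot : 1 \notin x1 :: s.
  apply/negP => /le_q; rewrite normr1 => /le_lt_trans/(_ q_lt1).
  by rewrite ltxx.
have -> : x0 = 1.
  by move: root1; rewrite in_cons (negbTE Nroot) orbF => /eqP.
by exists `|1 - rho|, (x1 :: s).
Qed.

(** The weighted norm contracts by [(cost_ratio a)^-1] on vectors of weighted sum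
    0: this factor does not depend on [beta]. *)
Lemma consensus_step_contraction (R : realType) (n : nat) (a : 'I_n -> R)
    (e : rel 'I_n) (beta : R) (mu : 'I_n -> R) (i0 : 'I_n) :
  (forall i, 0 < a i) -> symmetric e -> well_connected a e beta ->
  wsum a mu = 0 ->
  cost_ratio a ^+ 2 * wnorm a (consensus_step a e beta mu) <= wnorm a mu.
Proof.
move=> a_gt0 e_sym wc mu0.
have [q [s [chB Nroot le_q [q_ge0 qk]]]] :=
  well_connected_spectrum i0 a_gt0 e_sym wc.
have k_ge1 := cost_ratio_ge1 (a_gt0 i0).
have r_neq0 i : Num.sqrt (2 * a i) != 0 by rewrite sqrtr_eq0 -ltNge mulr_gt0.
pose w : 'rV_n := \row_i ((fun=> 1) i / Num.sqrt (2 * a i)).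
pose v : 'rV_n := \row_i (mu i / Num.sqrt (2 * a i)).
have wB : w *m scaled_consensus_mx a e beta = 1 *: w.
  rewrite (mul_scaled_consensus _ _ a_gt0 e_sym) scale1r.
  by apply/rowP => j; rewrite !mxE consensus_step_const.
have w_neq0 : w != 0.
  apply/eqP => /rowP/(_ i0); rewrite !mxE mul1r => /eqP.
  by rewrite invr_eq0 (negbTE (r_neq0 _)).
have vw : \sum_i v 0 i * w 0 i = 0.
  rewrite -[RHS]mu0 /wsum; apply: eq_bigr => i _; rewrite !mxE.
  rewrite mul1r -mulrA mulrC.
  by rewrite -invfM -expr2 sqr_sqrtr// mulr_ge0// ltW.
have := sym_contraction_orth (scaled_consensus_sym _ _ e_sym)
  chB Nroot le_q w_neq0 wB vw.
rewrite (mul_scaled_consensus _ _ a_gt0 e_sym) -!wnormE// => le_step.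
apply: le_trans (ler_wpM2l (sqr_ge0 _) le_step) _.
rewrite mulrA -exprMn mulrC ler_piMr//.
  by apply: sumr_ge0 => i _; rewrite mulr_ge0 ?sqr_ge0// invr_ge0 mulr_ge0// ltW.
apply: exprn_ile1; last by rewrite mulrC ltW.
by rewrite mulr_ge0// (le_trans _ k_ge1).
Qed.

Lemma consensus_step_nonexpansive (R : realType) (n : nat) (a : 'I_n -> R)
    (e : rel 'I_n) (beta : R) (mu : 'I_n -> R) (i0 : 'I_n) :
  (forall i, 0 < a i) -> symmetric e -> well_connected a e beta ->
  wnorm a (consensus_step a e beta mu) <= wnorm a mu.
Proof.
move=> a_gt0 e_sym wc.
have [q [s [chB Nroot le_q [q_ge0 qk]]]] :=
  well_connected_spectrum i0 a_gt0 e_sym wc.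
have k_ge1 := cost_ratio_ge1 (a_gt0 i0).
have q_le1 : q <= 1 by apply: le_trans (ltW qk); rewrite ler_peMr.
have le1 x : x \in 1 :: s -> `|x| <= 1.
  by rewrite in_cons => /predU1P[->|/le_q/le_trans->//]; rewrite ?normr1.
have := sym_contraction (\row_i (mu i / Num.sqrt (2 * a i)))
  (scaled_consensus_sym a beta e_sym) chB le1.
by rewrite (mul_scaled_consensus _ _ a_gt0 e_sym) -!wnormE// expr1n mul1r.
Qed.

(** The exchanges along the two directions of each edge cancel. *)
Lemma wsum_consensus_step (R : realType) (n : nat) (a : 'I_n -> R)
    (e : rel 'I_n) (beta : R) (mu : 'I_n -> R) :
  (forall i, 0 < a i) -> symmetric e ->
  wsum a (consensus_step a e beta mu) = wsum a mu.
Proof.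
move=> a_gt0 e_sym; rewrite /wsum /consensus_step.
under eq_bigr => i _ do rewrite mulrBr -mulrA mulKf ?gt_eqF ?mulr_gt0//.
rewrite sumrB -mulr_sumr.
suff -> : \sum_i \sum_(l | e i l) (mu i - mu l) = 0 by rewrite mulr0 subr0.
under eq_bigr do rewrite sumrB.
rewrite sumrB [X in _ - X](exchange_big_dep predT)//=.
apply/eqP; rewrite subr_eq0; apply/eqP; apply: eq_bigr => i _.
by apply: eq_bigl => l; rewrite e_sym.
Qed.

(** * The perturbed iteration *)

(** Total power supplied per unit of common marginal cost. *)
Definition total_weight (R : realType) (n : nat) (a : 'I_n -> R) : R :=
  \sum_i (2 * a i)^-1.

(** Error on the marginal cost of [i] when a unit load change is shared equally,
    as the innovation term does, instead of optimally. *)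
Definition share_gap (R : realType) (n : nat) (a : 'I_n -> R) (i : 'I_n) : R :=
  2 * a i / n%:R - (total_weight a)^-1.

Lemma sqr_norm_le (R : realDomainType) (x y : R) :
  `|x| <= y -> x ^+ 2 <= y ^+ 2.
Proof.
move=> xy; have y_ge0 := le_trans (normr_ge0 x) xy.
by rewrite -[x ^+ 2]ger0_norm ?sqr_ge0// normrX lerXn2r ?nnegrE.
Qed.

Lemma wnorm_ge0 (R : realType) (n : nat) (a mu : 'I_n -> R) :
  (forall i, 0 < a i) -> 0 <= wnorm a mu.
Proof.
move=> a_gt0; apply: sumr_ge0 => i _.
by rewrite mulr_ge0 ?sqr_ge0// invr_ge0 mulr_ge0// ltW.
Qed.

(** Young's inequality [(x + y)^2 <= k x^2 + k / (k - 1) y^2]. *)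
Lemma wnormD_le (R : realType) (n : nat) (a x y : 'I_n -> R) (k : R) :
  (forall i, 0 < a i) -> 1 < k ->
  wnorm a (fun i => x i + y i) <= k * wnorm a x + k / (k - 1) * wnorm a y.
Proof.
move=> a_gt0 k_gt1; rewrite !mulr_sumr -big_split; apply: ler_sum => i _ /=.
rewrite !(mulrCA _ (2 * a i)^-1) -mulrDr ler_wpM2l//.
  by rewrite invr_ge0 mulr_ge0// ltW.
have k1_gt0 : 0 < k - 1 by rewrite subr_gt0.
rewrite -subr_ge0.
have -> : k * x i ^+ 2 + k / (k - 1) * y i ^+ 2 - (x i + y i) ^+ 2
  = ((k - 1) * x i - y i) ^+ 2 / (k - 1) by field; rewrite gt_eqF.
by rewrite divr_ge0 ?sqr_ge0// ltW.
Qed.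

Lemma wnormZ (R : realType) (n : nat) (a mu : 'I_n -> R) (c : R) :
  wnorm a (fun i => c * mu i) = c ^+ 2 * wnorm a mu.
Proof. by rewrite mulr_sumr; apply: eq_bigr => i _; rewrite exprMn mulrCA. Qed.

Lemma eq_wnorm (R : realType) (n : nat) (a x y : 'I_n -> R) :
  x =1 y -> wnorm a x = wnorm a y.
Proof. by move=> xy; apply: eq_bigr => i _; rewrite xy. Qed.

Lemma eq_wsum (R : realType) (n : nat) (a x y : 'I_n -> R) :
  x =1 y -> wsum a x = wsum a y.
Proof. by move=> xy; apply: eq_bigr => i _; rewrite xy. Qed.

Lemma total_weight_ge (R : realType) (n : nat) (a : 'I_n -> R) (i : 'I_n) :
  (forall i, 0 < a i) -> (2 * a i)^-1 <= total_weight a.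
Proof.
move=> a_gt0; rewrite /total_weight (bigD1 i)//= lerDl.
by apply: sumr_ge0 => j _; rewrite invr_ge0 mulr_ge0// ltW.
Qed.

Lemma total_weight_gt0 (R : realType) (n : nat) (a : 'I_n -> R) (i0 : 'I_n) :
  (forall i, 0 < a i) -> 0 < total_weight a.
Proof.
move=> a_gt0; apply: lt_le_trans (total_weight_ge i0 a_gt0).
by rewrite invr_gt0 mulr_gt0.
Qed.

(** When all costs are equal, equal sharing is optimal. *)
Lemma share_gap_eq0 (R : realType) (n : nat) (a : 'I_n -> R) (i : 'I_n) :
  (forall i, 0 < a i) -> cost_ratio a = 1 -> share_gap a i = 0.
Proof.
move=> a_gt0 k1; rewrite /share_gap /total_weight.
under eq_bigr => j _ do rewrite (cost_ratio_eq1 j i a_gt0 k1).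
have n_neq0 : n%:R != 0 :> R by rewrite pnatr_eq0 -lt0n; case: (n) i => [[]|].
have a_neq0 : a i != 0 by rewrite gt_eqF.
by rewrite sumr_const card_ord -mulr_natr; field; rewrite n_neq0 a_neq0.
Qed.

Lemma wsum_linear (R : realType) (n : nat) (a x y z : 'I_n -> R) (c d : R) :
  wsum a (fun i => x i + (c * y i - d * z i))
    = wsum a x + (c * wsum a y - d * wsum a z).
Proof.
by rewrite !mulr_sumr -sumrB -big_split; apply: eq_bigr => i _ /=; ring.
Qed.

Lemma wsum_equal_share (R : realType) (n : nat) (a : 'I_n -> R) (i0 : 'I_n) :
  (forall i, 0 < a i) -> wsum a (fun i => 2 * a i / n%:R) = 1.
Proof.
move=> a_gt0; rewrite /wsum.
under eq_bigr => i _ do rewrite mulKf ?gt_eqF ?mulr_gt0//.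
rewrite sumr_const card_ord -[LHS]mulr_natr mulVf//.
by rewrite pnatr_eq0 -lt0n; case: (n) i0 => [[]|].
Qed.

Lemma wsum_share_gap (R : realType) (n : nat) (a : 'I_n -> R) (i0 : 'I_n) :
  (forall i, 0 < a i) -> wsum a (share_gap a) = 0.
Proof.
move=> a_gt0; rewrite -[LHS](subrK 1) -{1}(wsum_equal_share i0 a_gt0).
rewrite /wsum /share_gap -sumrB.
under eq_bigr => i _ do rewrite -mulrBr addrAC subrr add0r mulrN.
by rewrite sumrN -mulr_suml divff ?addNr// gt_eqF ?(total_weight_gt0 i0).
Qed.

(** The next three constants, times [eps ^+ 2], bound the weighted norm of the
    error at the first slot, at the second slot, and the level from which the
    forcing cannot raise it. *)
Definition first_energy (R : realType) (n : nat) (a : 'I_n -> R) (K : R) : R :=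
  total_weight a * K ^+ 2.

Definition second_energy (R : realType) (n : nat) (a : 'I_n -> R) (K : R) : R :=
  2 * first_energy a K
  + 2 * (2 * wnorm a (share_gap a)
         + 2 * ((total_weight a * K) ^+ 2 * wnorm a (fun i => 2 * a i / n%:R))).

(** When [cost_ratio a = 1], both factors are 0: the first by the convention on
    inverses of 0, the second because [share_gap a] vanishes. *)
Definition steady_energy (R : realType) (n : nat) (a : 'I_n -> R) : R :=
  (cost_ratio a / (cost_ratio a - 1)) ^+ 2 * wnorm a (share_gap a).

Lemma first_energy_ge0 (R : realType) (n : nat) (a : 'I_n -> R) (K : R) :
  (forall i, 0 < a i) -> 0 <= first_energy a K.
Proof.
move=> a_gt0; rewrite mulr_ge0 ?sqr_ge0//.
by apply: sumr_ge0 => i _; rewrite invr_ge0 mulr_ge0// ltW.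
Qed.

Lemma second_energy_ge0 (R : realType) (n : nat) (a : 'I_n -> R) (K : R) :
  (forall i, 0 < a i) -> 0 <= second_energy a K.
Proof.
move=> a_gt0; rewrite addr_ge0 ?[0 <= 2 * _]mulr_ge0 ?first_energy_ge0//.
by rewrite addr_ge0// mulr_ge0 ?wnorm_ge0// mulr_ge0 ?sqr_ge0 ?wnorm_ge0.
Qed.

Lemma steady_energy_ge0 (R : realType) (n : nat) (a : 'I_n -> R) :
  (forall i, 0 < a i) -> 0 <= steady_energy a.
Proof. by move=> a_gt0; rewrite mulr_ge0 ?sqr_ge0 ?wnorm_ge0. Qed.

(** For errors of weighted sum 0, the ball of squared radius [C] is invariant
    under the perturbed step. *)
Lemma perturbed_step_bound (R : realType) (n : nat) (a : 'I_n -> R)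
    (e : rel 'I_n) (beta : R) (mu : 'I_n -> R) (i0 : 'I_n) (delta eps C : R) :
  (forall i, 0 < a i) -> symmetric e -> well_connected a e beta ->
  wsum a mu = 0 -> `|delta| <= eps ->
  steady_energy a * eps ^+ 2 <= C ->
  wnorm a mu <= C ->
  wnorm a (fun i => consensus_step a e beta mu i + delta * share_gap a i) <= C.
Proof.
move=> a_gt0 e_sym wc mu0 delta_eps; rewrite /steady_energy.
set k := cost_ratio a; set G := wnorm _ _.
move=> GC muC.
have k_ge1 : 1 <= k := cost_ratio_ge1 (a_gt0 i0).
(* for [k = 1] the forcing vanishes; for [k > 1] Young's inequality with the
   parameter [k] uses up one of the two factors [k^-1] by which the squared norm
   contracts *)
have [k1|k_neq1] := eqVneq k 1.
  apply: le_trans muC.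
  rewrite (@eq_wnorm _ _ _ _ (consensus_step a e beta mu)).
    exact: consensus_step_nonexpansive i0 _ _ _.
  by move=> i; rewrite share_gap_eq0// mulr0 addr0.
have k_gt1 : 1 < k by rewrite lt_neqAle eq_sym k_neq1.
have k_gt0 : 0 < k by apply: lt_trans k_gt1.
have k1_gt0 : 0 < k - 1 by rewrite subr_gt0.
apply: le_trans (wnormD_le _ _ a_gt0 k_gt1) _; rewrite wnormZ -/G.
have G_ge0 : 0 <= G by exact: wnorm_ge0.
have delta2 := sqr_norm_le delta_eps.
have contr : k * wnorm a (consensus_step a e beta mu) <= C / k.
  rewrite ler_pdivlMr// mulrAC -expr2.
  exact: le_trans (consensus_step_contraction i0 a_gt0 e_sym wc mu0) muC.
have forc : k / (k - 1) * (delta ^+ 2 * G) <= C * ((k - 1) / k).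
  apply: (@le_trans _ _ (k / (k - 1) * (eps ^+ 2 * G))).
    by rewrite ler_wpM2l ?divr_ge0 ?(ltW k_gt0) ?(ltW k1_gt0)// ler_wpM2r.
  apply: le_trans (ler_wpM2r _ GC); last by rewrite divr_ge0 ?ltW.
  rewrite le_eqVlt; apply/orP; left; apply/eqP; field.
  by rewrite !gt_eqF.
apply: le_trans (lerD contr forc) _.
rewrite le_eqVlt; apply/orP; left; apply/eqP; field.
by rewrite gt_eqF.
Qed.

Lemma wnorm_unif_le (R : realType) (n : nat) (a mu : 'I_n -> R) (b : R) :
  (forall i, 0 < a i) -> (forall i, `|mu i| <= b) ->
  wnorm a mu <= total_weight a * b ^+ 2.
Proof.
move=> a_gt0 mu_b; rewrite mulr_suml; apply: ler_sum => i _.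
by rewrite ler_wpM2l ?sqr_norm_le// invr_ge0 mulr_ge0// ltW.
Qed.

Lemma wsum_unif_le (R : realType) (n : nat) (a mu : 'I_n -> R) (b : R) :
  (forall i, 0 < a i) -> (forall i, `|mu i| <= b) ->
  `|wsum a mu| <= total_weight a * b.
Proof.
move=> a_gt0 mu_b; apply: le_trans (ler_norm_sum _ _ _) _.
rewrite mulr_suml; apply: ler_sum => i _.
have w_ge0 : 0 <= (2 * a i)^-1 by rewrite invr_ge0 mulr_ge0// ltW.
by rewrite normrM ger0_norm// ler_wpM2l.
Qed.

(** The first step, whose starting error may have a nonzero weighted sum. *)
Lemma second_step_bound (R : realType) (n : nat) (a : 'I_n -> R)
    (e : rel 'I_n) (beta : R) (mu : 'I_n -> R) (i0 : 'I_n) (delta eps K : R) :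
  (forall i, 0 < a i) -> symmetric e -> well_connected a e beta ->
  `|delta| <= eps -> (forall i, `|mu i| <= K * eps) ->
  wnorm a (fun i => consensus_step a e beta mu i
             + (delta * share_gap a i - wsum a mu * (2 * a i / n%:R)))
    <= second_energy a K * eps ^+ 2.
Proof.
move=> a_gt0 e_sym wc delta_eps mu_K.
have two : (1 : R) < 2 by rewrite ltr1n.
have two2 : 2 / (2 - 1) = 2 :> R by field.
apply: le_trans (wnormD_le _ _ a_gt0 two) _; rewrite two2.
have step_le := le_trans (consensus_step_nonexpansive mu i0 a_gt0 e_sym wc)
  (wnorm_unif_le a_gt0 mu_K).
have forc_le : wnorm a (fun i => delta * share_gap a i
      - wsum a mu * (2 * a i / n%:R))
    <= 2 * (delta ^+ 2 * wnorm a (share_gap a))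
       + 2 * (wsum a mu ^+ 2 * wnorm a (fun i => 2 * a i / n%:R)).
  rewrite (@eq_wnorm _ _ _ _ (fun i => delta * share_gap a i
     + (- wsum a mu) * (2 * a i / n%:R))) => [|i]; last by rewrite mulNr.
  apply: le_trans (wnormD_le _ _ a_gt0 two) _; rewrite two2.
  by rewrite !wnormZ sqrrN.
have G_ge0 := wnorm_ge0 (share_gap a) a_gt0.
have H_ge0 := wnorm_ge0 (fun i => 2 * a i / n%:R) a_gt0.
have d2 := ler_wpM2r G_ge0 (sqr_norm_le delta_eps).
have m2 := ler_wpM2r H_ge0 (sqr_norm_le (wsum_unif_le a_gt0 mu_K)).
move: d2 m2 forc_le step_le; rewrite /second_energy /first_energy.
set G := wnorm a (share_gap a); set H := wnorm a (fun i => _ / _).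
set S := total_weight a; rewrite !exprMn => *; lra.
Qed.

(** * Deviation from the optimal dispatch *)

Lemma optimal_price (R : realType) (n : nat) (a v : 'I_n -> R) (P mu : R) :
  (forall i, 0 < a i) -> optimal_dispatch a P v -> lagrange_multiplier a v mu ->
  (forall i, v i = (2 * a i)^-1 * mu) /\ P = total_weight a * mu.
Proof.
move=> a_gt0 [<- _] stat.
have vE i : v i = (2 * a i)^-1 * mu.
  move/eqP: (stat i); rewrite subr_eq0 => /eqP <-.
  by rewrite mulKf// gt_eqF ?mulr_gt0.
by split=> //; rewrite mulr_suml; apply: eq_bigr.
Qed.

Theorem theorem2 (R : realType) (n : nat) (a : 'I_n -> R) (e : rel 'I_n)
    (a_gt0 : forall i, 0 < a i) (e_sym : symmetric e) (e_irr : irreflexive e)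
    (K : R) (K_ge0 : 0 <= K) :
  exists c : R, 0 < c /\
    forall (beta : R) (T : nat) (eps : R) (PL : nat -> R)
           (Pm u lam lamt : 'I_n -> nat -> R)
           (ustar : 'I_n -> nat -> R) (lamstar : nat -> R),
      0 < beta ->
      well_connected a e beta ->
      (forall t, in_horizon T t -> `|PL t.+1 - PL t| < eps) ->
      distributed_scheme a e beta T PL Pm u lam lamt ->
      zero_time_constant T Pm u ->
      (forall t, in_horizon T t ->
         optimal_dispatch a (PL t) (fun i => ustar i t) /\
         lagrange_multiplier a (fun i => ustar i t) (lamstar t)) ->
      (forall i, `|lam i 1%N - lamstar 1%N| <= K * eps) ->
      (forall t i, in_horizon T t -> `|lam i t - lamstar t| <= c * eps) /\
      (forall t i, in_horizon T t -> `|u i t - ustar i t| <= c * eps).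
Proof.
set S := total_weight a.
pose C := first_energy a K + second_energy a K + steady_energy a.
pose A : R := \sum_i 2 * a i.
have S_ge0 : 0 <= S.
  by apply: sumr_ge0 => i _; rewrite invr_ge0 mulr_ge0// ltW.
have E1 := first_energy_ge0 K a_gt0; have E2 := second_energy_ge0 K a_gt0.
have E3 := steady_energy_ge0 a_gt0.
have C_ge0 : 0 <= C by rewrite /C; lra.
have A_ge0 : 0 <= A by apply: sumr_ge0 => i _; rewrite mulr_ge0// ltW.
have AC_ge0 := mulr_ge0 A_ge0 C_ge0.
have c0_ge0 : 0 <= 1 + A * C by rewrite addr_ge0.
(* [`|mu t i|^2 <= 2 * a i * C * eps^2 <= A * C * eps^2], and [x <= (1 + x)^2]
   avoids a square root; [1 + S] dominates both 1 and [(2 * a i)^-1] *)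
exists ((1 + S) * (1 + A * C)); split; first by rewrite mulr_gt0// ltr_wpDr.
move=> beta T eps PL Pm u lam lamt ustar lamstar _ wc PL_eps scheme ztc opt init.
pose mu t i := lam i t - lamstar t.
have next_horizon t : in_horizon T t.+1 -> (0 < t)%N -> in_horizon T t.
  by rewrite /in_horizon => /andP[_ tT] t_gt0; rewrite t_gt0 ltnW.
have ustarE t i (hT : in_horizon T t) : ustar i t = (2 * a i)^-1 * lamstar t.
  have [o l] := opt t hT; exact: (optimal_price a_gt0 o l).1.
have PLE t (hT : in_horizon T t) : PL t = S * lamstar t.
  have [o l] := opt t hT; exact: (optimal_price a_gt0 o l).2.
have PmE t i (hT : in_horizon T t) : Pm i t = (2 * a i)^-1 * lam i t.
  by rewrite (scheme_marginal_cost scheme)// mulKf// gt_eqF// mulr_gt0.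
have sumPm t (hT : in_horizon T t) : \sum_j Pm j t = PL t + wsum a (mu t).
  rewrite PLE// mulr_suml -big_split; apply: eq_bigr => j _ /=.
  by rewrite PmE// -mulrDr addrC subrK.
(* the error dynamics; the innovation term sees the imbalance of slot [t] *)
have step t i : (0 < t)%N -> in_horizon T t.+1 ->
    mu t.+1 i = consensus_step a e beta (mu t) i
      + ((PL t.+1 - PL t) * share_gap a i
         - wsum a (mu t) * (2 * a i / n%:R)).
  move=> t_gt0 hT1; have hT := next_horizon t hT1 t_gt0.
  have -> : mu t.+1 i = lamt i t.+1 - lamstar t.+1.
    rewrite /mu (scheme_marginal_cost scheme)// ztc// (scheme_control scheme)//.
    by rewrite mulVKf// gt_eqF// mulr_gt0.
  rewrite (scheme_innovation scheme)// sumPm// /consensus_step /share_gap.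
  have -> : \sum_(l | e i l) (mu t i - mu t l)
      = \sum_(l | e i l) (lam i t - lam l t).
    by apply: eq_bigr => l _; rewrite /mu; ring.
  have S_neq0 : S != 0 by rewrite gt_eqF// (total_weight_gt0 i).
  have n_neq0 : n%:R != 0 :> R by rewrite pnatr_eq0 -lt0n; case: (n) i => [[]|].
  rewrite -/S /mu !PLE//; field.
  by rewrite S_neq0 n_neq0.
have balanced t (i0 : 'I_n) : in_horizon T t.+2 -> wsum a (mu t.+2) = 0
  /\ wnorm a (mu t.+2) <= C * eps ^+ 2.
  (* the innovation restores the power balance in one step *)
  have wsum_step s : in_horizon T s.+2 -> wsum a (mu s.+2) = 0.
    move=> hT2; rewrite (eq_wsum _ (fun i => step s.+1 i isT hT2)).
    rewrite wsum_linear wsum_consensus_step// (wsum_share_gap i0)//.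
    by rewrite (wsum_equal_share i0)// mulr0 add0r mulr1 subrr.
  elim: t => [|t IHt] hT; split; try exact: wsum_step.
    have hT1 := next_horizon _ hT isT.
    rewrite (eq_wnorm _ (fun i => step 1%N i isT hT)).
    apply: le_trans (second_step_bound i0 a_gt0 e_sym wc
      (ltW (PL_eps _ hT1)) init) _.
    by rewrite ler_wpM2r ?sqr_ge0// /C; lra.
  have hT1 := next_horizon _ hT isT; have [mu0 muC] := IHt hT1.
  rewrite (@eq_wnorm _ _ _ _ (fun i => consensus_step a e beta (mu t.+2) i
    + (PL t.+3 - PL t.+2) * share_gap a i)) => [|i]; last first.
    by rewrite (step t.+2)// mu0 mul0r subr0.
  have steady_le : steady_energy a * eps ^+ 2 <= C * eps ^+ 2.
    by rewrite ler_wpM2r ?sqr_ge0// /C; lra.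
  exact: (perturbed_step_bound i0 a_gt0 e_sym wc mu0
    (ltW (PL_eps _ hT1)) steady_le muC).
have energy t (i0 : 'I_n) : in_horizon T t -> wnorm a (mu t) <= C * eps ^+ 2.
  case: t => [//|[|t]] hT; last by have [] := balanced t i0 hT.
  apply: le_trans (wnorm_unif_le a_gt0 init) _.
  by rewrite exprMn mulrA -/(first_energy a K) ler_wpM2r ?sqr_ge0// /C; lra.
have mu_le t i (hT : in_horizon T t) : `|mu t i| <= (1 + A * C) * eps.
  have eps_ge0 : 0 <= eps by apply: le_trans (ltW (PL_eps t hT)).
  rewrite -ler_sqr ?nnegrE ?mulr_ge0// real_normK ?num_real//.
  have a2_gt0 : 0 < 2 * a i by rewrite mulr_gt0.
  have mu2 : mu t i ^+ 2 <= A * (C * eps ^+ 2).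
    apply: (@le_trans _ _ (2 * a i * wnorm a (mu t))).
      rewrite -ler_pdivrMl// /wnorm (bigD1 i)//= lerDl.
      by apply: sumr_ge0 => j _; rewrite mulr_ge0 ?sqr_ge0// invr_ge0 mulr_ge0// ltW.
    apply: ler_pM; rewrite ?wnorm_ge0 ?(ltW a2_gt0) ?energy//.
    by rewrite /A (bigD1 i)//= lerDl; apply: sumr_ge0 => j _; rewrite mulr_ge0// ltW.
  apply: le_trans mu2 _; rewrite mulrA exprMn ler_wpM2r ?sqr_ge0//.
  by nra.
split=> t i hT.
  have eps_ge0 : 0 <= eps by apply: le_trans (ltW (PL_eps t hT)).
  apply: le_trans (mu_le t i hT) _.
  by rewrite -mulrA ler_peMl ?mulr_ge0// lerDl.
have eps_ge0 : 0 <= eps by apply: le_trans (ltW (PL_eps t hT)).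
have w_gt0 : 0 < (2 * a i)^-1 by rewrite invr_gt0 mulr_gt0.
rewrite -(ztc t i hT) PmE// ustarE// -mulrBr normrM (ger0_norm (ltW w_gt0)) -mulrA.
apply: ler_pM => //; first exact: ltW.
  by apply: le_trans (total_weight_ge i a_gt0) _; rewrite lerDr.
exact: mu_le.
Qed.
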